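(* The homotopy braid group $\widehat{B}_3$ is torsion-free, i.e. it has no non-identity element of finite order.
   Context: Notation: for elements $a,b$ of a group, $a^b = b^{-1}ab$ and $[a,b] = a^{-1}b^{-1}ab$. The braid group $B_n$, $n \geq 2$, is the group generated by $\sigma_1,\ldots,\sigma_{n-1}$ with defining relations $\sigma_i\sigma_{i+1}\sigma_i = \sigma_{i+1}\sigma_i\sigma_{i+1}$ for $i=1,\ldots,n-2$, and $\sigma_i\sigma_j=\sigma_j\sigma_i$ for $|i-j|\geq 2$. For $1 \le i<j\le n$ define elements $a_{ij}\in B_n$ by $a_{i,i+1}=\sigma_i^2$ and $a_{ij} = \sigma_{j-1}\sigma_{j-2}\cdots\sigma_{i+1}\,\sigma_i^2\,\sigma_{i+1}^{-1}\cdots\sigma_{j-2}^{-1}\sigma_{j-1}^{-1}$ for $i+1<j\leq n$ (these generate the pure braid group $P_n$). The homotopy braid group $\widehat{B}_n$ is the quotient of $B_n$ by the relations $[a_{ik}, a_{ik}^g]=1$ for all $1\leq i<k\leq n$ and all $g\in\langle a_{1k},a_{2k},\ldots,a_{k-1,k}\rangle$ (i.e. the quotient of $B_n$ by the normal closure of these elements). The theorem concerns the case $n=3$, where $a_{12}=\sigma_1^2$, $a_{23}=\sigma_2^2$, $a_{13}=\sigma_2\sigma_1^2\sigma_2^{-1}$. *)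

(* Defs.v *)
(* The relations being quotiented are not a priori decidable: `[< _ >] makes
   them boolean, as generic_quotient requires. *)
From HB Require Import structures.
From Stdlib Require Import Relation_Operators.
From mathcomp Require Import all_boot.
From mathcomp Require Import boolp classical_sets.

Set Implicit Arguments.
Unset Strict Implicit.
Unset Printing Implicit Defensive.

Local Open Scope classical_set_scope.
Local Open Scope group_scope.
Local Open Scope quotient_scope.

(* The letter (x, false) stands for x and (x, true) for x^-1. *)
Section FreeGroup.
Variable T : choiceType.
Implicit Types u v w : seq (T * bool).

Variant cancel_step : seq (T * bool) -> seq (T * bool) -> Prop :=
  CancelStep u v x b : cancel_step (u ++ (x, b) :: (x, ~~ b) :: v) (u ++ v).

Definition free_eq u v : bool := `[< clos_refl_sym_trans _ cancel_step u v >].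

Lemma free_eq_refl : reflexive free_eq.
Proof. by move=> u; apply/asboolP; exact: rst_refl. Qed.

Lemma free_eq_sym : symmetric free_eq.
Proof. by move=> u v; apply/asboolP/asboolP; exact: rst_sym. Qed.

Lemma free_eq_trans : transitive free_eq.
Proof.
by move=> v u w /asboolP uv /asboolP vw; apply/asboolP; exact: rst_trans vw.
Qed.

Canonical free_eq_equiv := EquivRel free_eq free_eq_refl free_eq_sym free_eq_trans.

Definition free_group : Type := {eq_quot free_eq}.
HB.instance Definition _ : EqQuotient (seq (T * bool)) free_eq free_group := EqQuotient.on free_group.
HB.instance Definition _ := Choice.on free_group.

Lemma free_eq_cancel u v x b :
  free_eq (u ++ (x, b) :: (x, ~~ b) :: v) (u ++ v).
Proof. by apply/asboolP; apply: rst_step; exact: CancelStep. Qed.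

Lemma free_eq_catl w u v : free_eq u v -> free_eq (w ++ u) (w ++ v).
Proof.
move=> /asboolP uv; apply/asboolP; elim: uv => {u v}.
- move=> _ _ [u v x b]; apply: rst_step; rewrite !catA; exact: CancelStep.
- by move=> u; exact: rst_refl.
- by move=> u v _; exact: rst_sym.
- by move=> u v t _ uv _; exact: rst_trans.
Qed.

Lemma free_eq_catr w u v : free_eq u v -> free_eq (u ++ w) (v ++ w).
Proof.
move=> /asboolP uv; apply/asboolP; elim: uv => {u v}.
- move=> _ _ [u v x b]; apply: rst_step.
  by rewrite -!catA !cat_cons; exact: CancelStep.
- by move=> u; exact: rst_refl.
- by move=> u v _; exact: rst_sym.
- by move=> u v t _ uv _; exact: rst_trans.
Qed.

Definition word_inv u : seq (T * bool) := rev [seq (p.1, ~~ p.2) | p <- u].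

Lemma word_invK : involutive word_inv.
Proof.
move=> u; rewrite /word_inv map_rev revK -map_comp.
by rewrite -[RHS]map_id; apply: eq_map => -[x b] /=; rewrite negbK.
Qed.

Lemma word_inv_cat u v : word_inv (u ++ v) = word_inv v ++ word_inv u.
Proof. by rewrite /word_inv map_cat rev_cat. Qed.

Lemma free_eq_inv u v : free_eq u v -> free_eq (word_inv u) (word_inv v).
Proof.
move=> /asboolP uv; apply/asboolP; elim: uv => {u v}.
- move=> _ _ [u v x b]; apply: rst_step.
  rewrite -[_ :: _]/([:: (x, b); (x, ~~ b)] ++ v) !word_inv_cat -catA.
  by rewrite [word_inv [:: _; _]]/word_inv /= negbK; exact: CancelStep.
- by move=> u; exact: rst_refl.
- by move=> u v _; exact: rst_sym.
- by move=> u v t _ uv _; exact: rst_trans.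
Qed.

Lemma free_eq_invr u : free_eq (u ++ word_inv u) [::].
Proof.
elim/last_ind: u => [|u [x b] IHu]; first exact: free_eq_refl.
rewrite -cats1 word_inv_cat -!catA /=.
exact: free_eq_trans (free_eq_cancel _ _ _ _) IHu.
Qed.

Definition free_one : free_group := \pi [::].
Definition free_mul := lift_op2 free_group (@cat (T * bool)).
Definition free_inv := lift_op1 free_group word_inv.

Lemma pi_free_mul : {morph \pi_free_group : u v / u ++ v >-> free_mul u v}.
Proof.
move=> u v; unlock free_mul; apply/eqmodP.
apply: (@free_eq_trans (repr (\pi_free_group u) ++ v)).
  apply: free_eq_catr; rewrite free_eq_sym.
  by apply/(@eqmodP _ free_eq_equiv); rewrite reprK.
apply: free_eq_catl; rewrite free_eq_sym.
by apply/(@eqmodP _ free_eq_equiv); rewrite reprK.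
Qed.

Lemma pi_free_inv : {morph \pi_free_group : u / word_inv u >-> free_inv u}.
Proof.
move=> u; unlock free_inv; apply/eqmodP; apply: free_eq_inv.
by rewrite free_eq_sym; apply/(@eqmodP _ free_eq_equiv); rewrite reprK.
Qed.

Lemma free_mulA : associative free_mul.
Proof.
by elim/quotW=> u; elim/quotW=> v; elim/quotW=> w; rewrite -!pi_free_mul catA.
Qed.

Lemma free_mul1 : left_id free_one free_mul.
Proof. by elim/quotW=> u; rewrite /free_one -pi_free_mul. Qed.

Lemma free_mulr1 : right_id free_one free_mul.
Proof. by elim/quotW=> u; rewrite /free_one -pi_free_mul cats0. Qed.

Lemma free_mulrV : right_inverse free_one free_inv free_mul.
Proof.
elim/quotW=> u; rewrite /free_one -pi_free_inv -pi_free_mul.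
by apply/eqmodP; exact: free_eq_invr.
Qed.

Lemma free_mulV : left_inverse free_one free_inv free_mul.
Proof.
elim/quotW=> u; rewrite -{2}[u]word_invK -!pi_free_inv.
by rewrite (pi_free_inv (word_inv u)) free_mulrV.
Qed.

HB.instance Definition _ := isGroup.Build free_group
  free_mulA free_mul1 free_mulr1 free_mulV free_mulrV.

Definition free_gen (x : T) : free_group := \pi [:: (x, false)].

End FreeGroup.

Section GroupQuotient.
Variable G : groupType.
Implicit Types (A : set G) (x y g : G).

Inductive subgroup_gen A : set G :=
| subgroup_gen_mem x : A x -> subgroup_gen A x
| subgroup_gen1 : subgroup_gen A 1
| subgroup_genM x y : subgroup_gen A x -> subgroup_gen A y ->
    subgroup_gen A (x * y)
| subgroup_genV x : subgroup_gen A x -> subgroup_gen A x^-1.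

Definition normal_closure A : set G :=
  subgroup_gen [set r ^ g | r in A & g in [set: G]].

Lemma normal_closureJ A x g :
  normal_closure A x -> normal_closure A (x ^ g).
Proof.
elim=> {x} [_ [r Ar [h _ <-]]||x y _ IHx _ IHy|x _ IHx].
- by rewrite -conjgM; apply: subgroup_gen_mem; exists r => //; exists (h * g).
- by rewrite conj1g; exact: subgroup_gen1.
- by rewrite conjMg; exact: subgroup_genM.
- by rewrite conjVg; exact: subgroup_genV.
Qed.

Variable A : set G.

Definition quot_eq x y : bool := `[< normal_closure A (x^-1 * y) >].

Lemma quot_eq_refl : reflexive quot_eq.
Proof. by move=> x; apply/asboolP; rewrite mulVg; exact: subgroup_gen1. Qed.

Lemma quot_eq_sym : symmetric quot_eq.
Proof.
by move=> x y; apply/asboolP/asboolP => /subgroup_genV; rewrite invgM invgK.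
Qed.

Lemma quot_eq_trans : transitive quot_eq.
Proof.
move=> y x z /asboolP xy /asboolP yz; apply/asboolP.
have -> : x^-1 * z = (x^-1 * y) * (y^-1 * z) by rewrite mulgA mulgK.
by exact: subgroup_genM.
Qed.

Canonical quot_eq_equiv := EquivRel quot_eq quot_eq_refl quot_eq_sym quot_eq_trans.

(* The group G subjected to the additional relations r = 1, for r in A. *)
Definition group_quot : Type := {eq_quot quot_eq}.
HB.instance Definition _ : EqQuotient G quot_eq group_quot := EqQuotient.on group_quot.
HB.instance Definition _ := Choice.on group_quot.

Lemma quot_eqM x x' y y' :
  quot_eq x x' -> quot_eq y y' -> quot_eq (x * y) (x' * y').
Proof.
move=> /asboolP xx' /asboolP yy'; apply/asboolP.
have -> : (x * y)^-1 * (x' * y') = (x^-1 * x') ^ y * (y^-1 * y').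
  by rewrite /conjg invgM !mulgA mulgK.
by apply: subgroup_genM => //; exact: normal_closureJ.
Qed.

Lemma quot_eqV x y : quot_eq x y -> quot_eq x^-1 y^-1.
Proof.
rewrite quot_eq_sym => /asboolP yx; apply/asboolP; rewrite invgK.
have -> : x * y^-1 = (y^-1 * x) ^ y^-1.
  by rewrite /conjg invgK !mulgA mulgV mul1g.
exact: normal_closureJ.
Qed.

Definition quot_one : group_quot := \pi 1.
Definition quot_mul := lift_op2 group_quot (fun x y : G => x * y).
Definition quot_inv := lift_op1 group_quot (fun x : G => x^-1).

Lemma pi_quot_mul : {morph \pi_group_quot : x y / x * y >-> quot_mul x y}.
Proof.
move=> x y; unlock quot_mul; apply/eqmodP; apply: quot_eqM;
  by apply/(@eqmodP _ quot_eq_equiv); rewrite reprK.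
Qed.

Lemma pi_quot_inv : {morph \pi_group_quot : x / x^-1 >-> quot_inv x}.
Proof.
move=> x; unlock quot_inv; apply/eqmodP; apply: quot_eqV.
by apply/(@eqmodP _ quot_eq_equiv); rewrite reprK.
Qed.

Lemma quot_mulA : associative quot_mul.
Proof.
by elim/quotW=> x; elim/quotW=> y; elim/quotW=> z; rewrite -!pi_quot_mul mulgA.
Qed.

Lemma quot_mul1 : left_id quot_one quot_mul.
Proof. by elim/quotW=> x; rewrite /quot_one -pi_quot_mul mul1g. Qed.

Lemma quot_mulr1 : right_id quot_one quot_mul.
Proof. by elim/quotW=> x; rewrite /quot_one -pi_quot_mul mulg1. Qed.

Lemma quot_mulV : left_inverse quot_one quot_inv quot_mul.
Proof.
by elim/quotW=> x; rewrite /quot_one -pi_quot_inv -pi_quot_mul mulVg.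
Qed.

Lemma quot_mulrV : right_inverse quot_one quot_inv quot_mul.
Proof.
by elim/quotW=> x; rewrite /quot_one -pi_quot_inv -pi_quot_mul mulgV.
Qed.

HB.instance Definition _ := isGroup.Build group_quot
  quot_mulA quot_mul1 quot_mulr1 quot_mulV quot_mulrV.

End GroupQuotient.

(* Indices are shifted by one: the generators of B_n are numbered 0, ..., n-2
   and the strands 0, ..., n-1. A relation u = v is given by the relator u / v. *)
Definition braid_relators (n : nat) : set (free_group 'I_n.-1) :=
  let s := @free_gen 'I_n.-1 in
  [set r | exists i j : 'I_n.-1, j = i.+1 :> nat /\
             r = (s i * s j * s i) / (s j * s i * s j)] `|`
  [set r | exists i j : 'I_n.-1, ((i.+1 < j) || (j.+1 < i))%N /\
             r = (s i * s j) / (s j * s i)].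

Definition braid_group (n : nat) : groupType := group_quot (@braid_relators n).

(* Equal to 1 when k is not a valid index, that is, when k >= n-1. *)
Definition sigma (n k : nat) : braid_group n :=
  if insub k is Some i then \pi_(braid_group n) (free_gen (i : 'I_n.-1)) else 1.

(* a_ij = (s_{j-1} ... s_{i+1}) s_i^2 (s_{j-1} ... s_{i+1})^-1 for i < j < n. *)
Definition pure_gen (n i j : nat) : braid_group n :=
  let c := \prod_(k <- rev (index_iota i.+1 j)) sigma n k in
  c * sigma n i ^+ 2 * c^-1.

Definition homotopy_relators (n : nat) : set (braid_group n) :=
  [set r | exists i k : nat, exists g : braid_group n,
     [/\ (i < k < n)%N,
         subgroup_gen [set pure_gen n j k | j in [set j | (j < k)%N]] g &
         r = [~ pure_gen n i k, pure_gen n i k ^ g]]].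

Definition homotopy_braid_group (n : nat) : groupType :=
  group_quot (@homotopy_relators n).

Definition torsion_free (G : groupType) : Prop :=
  forall (x : G) (m : nat), (0 < m)%N -> x ^+ m = 1 -> x = 1.

(* Main.v *)
(* The pure braids are generated by z = (s t s)^2, which is central, and
   b = a_13, d = a_23. The homotopy relators say exactly that [b, d] commutes with
   b and d, so every element of the quotient is w b^k d^l [b, d]^i z^n with w one
   of six coset representatives of the pure braids. It maps to the group [heis3]
   below, in which the integers k, l, i, n can be read off; hence pure elements
   have infinite order. If w is a transposition, a coordinate of x^2 is congruent
   to 2 mod 4; if w is a 3-cycle, either a coordinate of the image of x^3 in Z^3
   is nonzero, or its central coordinate is nonzero mod 9. *)
From HB Require Import structures.
From mathcomp Require Import all_boot perm all_algebra.
From mathcomp Require Import boolp classical_sets.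
From mathcomp Require Import ring zify.
Require Import Defs.

Set Implicit Arguments.
Unset Strict Implicit.
Unset Printing Implicit Defensive.

Import GRing.Theory.
Local Open Scope classical_set_scope.
Local Open Scope group_scope.
Local Open Scope quotient_scope.

(** * Universal properties of free groups and of quotients by relators *)

Section QuotientMorphism.
Variables (G : groupType) (A : set G).
Implicit Types x y : G.

Lemma quot_piM x y :
  \pi_(group_quot A) (x * y) = \pi_(group_quot A) x * \pi_(group_quot A) y.
Proof. exact: pi_quot_mul. Qed.

Lemma quot_piV x : \pi_(group_quot A) x^-1 = (\pi_(group_quot A) x)^-1.
Proof. exact: pi_quot_inv. Qed.

Lemma quot_pi_rel x : A x -> \pi_(group_quot A) x = 1.
Proof.
move=> Ax; apply/eqP; rewrite eq_sym; apply/eqP/eqmodP/asboolP.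
rewrite invg1 mul1g; apply: subgroup_gen_mem; exists x => //.
by exists 1 => //; rewrite conjg1.
Qed.
End QuotientMorphism.

Lemma free_group_lift (T : choiceType) (G : groupType) (f : T -> G) :
  exists F : UMagmaMorphism.type (free_group T) G,
    forall x, F (free_gen x) = f x.
Proof.
pose ev (u : seq (T * bool)) := \prod_(l <- u) (if l.2 then (f l.1)^-1 else f l.1).
have ev_eq u v : free_eq u v -> ev u = ev v.
  move/asboolP; elim=> {u v} [_ _ [u v x b]|u|u v _ ->|u w v _ -> _ ->] //.
  by rewrite /ev !big_cat !big_cons /=; case: b; rewrite ?mulKg ?mulVKg.
have evM u v : ev (u ++ v) = ev u * ev v by rewrite /ev big_cat.
pose F (x : free_group T) := ev (repr x).
have Fpi u : F (\pi u) = ev u.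
  by apply: ev_eq; apply/(@eqmodP _ (free_eq_equiv T)); rewrite reprK.
have FM : {morph F : x y / x * y}.
  elim/quotW=> u; elim/quotW=> v.
  by rewrite -[_ * _]/(free_mul _ _) -pi_free_mul !Fpi evM.
have F1 : F 1 = 1 by rewrite -[1]/(free_one T) Fpi /ev big_nil.
pose FH := isUMagmaMorphism.Build _ _ F (conj F1 FM).
exists (HB.pack_for (UMagmaMorphism.type (free_group T) G) F FH) => x /=.
by rewrite /free_gen Fpi /ev big_cons big_nil mulg1.
Qed.

Lemma group_quot_lift (G H : groupType) (A : set G)
    (F : UMagmaMorphism.type G H) :
  (forall r, A r -> F r = 1) ->
  exists K : UMagmaMorphism.type (group_quot A) H,
    forall x, K (\pi_(group_quot A) x) = F x.
Proof.
move=> FA; have F_eq x y : quot_eq A x y -> F x = F y.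
  move/asboolP=> xy; apply/esym; rewrite -[y](mulVKg x) gmulfM.
  suff -> : F (x^-1 * y) = 1 by rewrite mulg1.
  elim: xy => {x y} [_ [r Ar [g _ <-]]||x y _ Fx _ Fy|x _ Fx].
  - by rewrite gmulfJ FA // conj1g.
  - exact: gmulf1.
  - by rewrite gmulfM Fx Fy mulg1.
  - by rewrite gmulfV Fx invg1.
pose K (x : group_quot A) := F (repr x).
have Kpi x : K (\pi x) = F x.
  by apply: F_eq; apply/(@eqmodP _ (quot_eq_equiv A)); rewrite reprK.
have KM : {morph K : x y / x * y}.
  elim/quotW=> x; elim/quotW=> y.
  by rewrite -[_ * _]/(quot_mul _ _) -pi_quot_mul !Kpi gmulfM.
have K1 : K 1 = 1 by rewrite -[1]/(quot_one A) Kpi gmulf1.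
pose KH := isUMagmaMorphism.Build _ _ K (conj K1 KM).
by exists (HB.pack_for (UMagmaMorphism.type (group_quot A) H) K KH).
Qed.

Lemma free_group_ind (T : choiceType) (P : free_group T -> Prop) :
  P 1 -> (forall x u, P u -> P (free_gen x * u)) ->
  (forall x u, P u -> P ((free_gen x)^-1 * u)) -> forall u, P u.
Proof.
move=> P1 Pg PV; elim/quotW; elim=> [|[x b] u IHu]; first exact: P1.
rewrite -cat1s pi_free_mul; case: b; last exact: Pg.
have -> : \pi_(free_group T) [:: (x, true)] = (free_gen x)^-1.
  by rewrite -[_^-1]/(free_inv _) -pi_free_inv.
exact: PV.
Qed.

(** * Integer powers in a group *)

Definition expgz (G : groupType) (x : G) (k : int) : G :=
  if k is Negz n then x ^- n.+1 else x ^+ `|k|%N.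

Section Expgz.
Variable G : groupType.
Implicit Types (x y e : G) (k l : int).

Lemma expgz1D x k : expgz x (1 + k)%R = x * expgz x k.
Proof.
case: k => [n|[|n]]; first exact: expgS.
  by rewrite /expgz expg1 mulgV.
have -> : (1 + Negz n.+1 = Negz n)%R by lia.
by rewrite /expgz [x ^+ n.+2]expgSr invgM mulVKg.
Qed.

Lemma expgzN1D x k : expgz x (-1 + k)%R = x^-1 * expgz x k.
Proof. by rewrite -{2}[k](GRing.addNKr 1%R) expgz1D mulKg. Qed.

(** Unit steps in both directions replace a case split on the sign of the exponent; [P] sees the
    exponent and the power together. *)
Lemma expgz_rec x (P : int -> G -> Prop) :
  P 0%R 1 -> (forall k y, P k y -> P (1 + k)%R (x * y)) ->
  (forall k y, P k y -> P (-1 + k)%R (x^-1 * y)) ->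
  forall k, P k (expgz x k).
Proof.
move=> P0 P1 PN; elim/int_rect=> [|n|n]; first exact: P0.
  by move/P1; rewrite -expgz1D -intS.
by move/PN; rewrite -expgzN1D -GRing.opprD -intS.
Qed.

Lemma expgzD x k l : expgz x (k + l)%R = expgz x k * expgz x l.
Proof.
pose Q i w := expgz x (i + l)%R = w * expgz x l.
apply: (@expgz_rec x Q) => [|i w Qw|i w Qw]; rewrite /Q.
- by rewrite GRing.add0r mul1g.
- by rewrite -GRing.addrA expgz1D Qw mulgA.
- by rewrite -GRing.addrA expgzN1D Qw mulgA.
Qed.

Lemma commute_expgz x y k : commute x y -> commute x (expgz y k).
Proof.
move=> xy; apply: (@expgz_rec y (fun _ => commute x)) => [|_ w|_ w].
- exact: commute1.
- exact: commuteM.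
- by apply: commuteM; exact: commuteV.
Qed.

Lemma expgzV x k : expgz x^-1 k = expgz x (- k)%R.
Proof.
apply: (@expgz_rec x^-1 (fun k y => y = expgz x (- k)%R)) => // l _ ->.
  by rewrite GRing.opprD expgzN1D.
by rewrite GRing.opprD GRing.opprK expgz1D invgK.
Qed.

(** Here [e] is the commutator $[y,x]$ and commutes with both, so each passage of [y] across one [x]
    costs exactly one factor [e]. *)
Lemma mulg_expgz_comm x y e k :
    commute e x -> commute e y -> y * x = x * y * e ->
  y * expgz x k = expgz x k * y * expgz e k.
Proof.
move=> ex ey yx.
have yVx : y * x^-1 = x^-1 * y * e^-1.
  apply: (mulgI x); apply: (mulIg e); rewrite !mulgA mulgV mul1g mulgVK.
  by rewrite -(mulgA _ x^-1) -(commuteV ex) mulgA -yx mulgK.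
pose Q l w := commute e w /\ y * w = w * y * expgz e l.
suff [] : Q k (expgz x k) by [].
apply: (@expgz_rec x Q) => [|l w [ew yw]|l w [ew yw]]; rewrite /Q.
- by split; [exact: commute1 | rewrite mul1g !mulg1].
- split; first exact: commuteM.
  rewrite mulgA yx expgz1D -mulgA ew -mulgA (mulgA y) yw.
  by rewrite (commute_expgz l (commute_refl e)) !mulgA.
- split; first by apply: commuteM => //; exact: commuteV.
  rewrite mulgA yVx expgzN1D -mulgA.
  have eVw : commute e^-1 w by apply: commute_sym; apply: commuteV.
  rewrite eVw -mulgA (mulgA y) yw.
  by rewrite (commute_expgz l (commute_sym (commuteV (commute_refl e)))) !mulgA.
Qed.
End Expgz.

Lemma gmulf_expgz (G H : groupType) (F : UMagmaMorphism.type G H) x k :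
  F (expgz x k) = expgz (F x) k.
Proof.
apply: (@expgz_rec G x (fun l y => F y = expgz (F x) l)) => [|l y Fy|l y Fy].
- exact: gmulf1.
- by rewrite gmulfM /= Fy expgz1D.
- by rewrite gmulfM /= gmulfV Fy expgzN1D.
Qed.

(** * Normal form for two generators with central commutator and a further central element *)

Section HeisenbergNormalForm.
Variables (G : groupType) (b d z : G).
Let c := [~ b, d].
Hypotheses (cb : commute c b) (cd : commute c d).
Hypotheses (zb : commute z b) (zd : commute z d).

Definition heis_nf (k l m n : int) : G :=
  expgz b k * expgz d l * expgz c m * expgz z n.

(** Normal forms ([K]) include 1 and are stable under left multiplication by each generator and its
    inverse ([L]). Carrying [L] for both [x] and [x^-1] lets the induction pass through products and
    inverses. *)
Lemma heis_nfP x :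
  subgroup_gen [set y | y = b \/ y = d \/ y = z] x ->
  exists k l m n, x = heis_nf k l m n.
Proof.
pose K x := exists k l m n, x = heis_nf k l m n.
pose L y := forall x, K x -> K (y * x).
have Lb : L b.
  move=> _ [k [l [m [n ->]]]]; exists (1 + k)%R, l, m, n.
  by rewrite /heis_nf expgz1D !mulgA.
have LbV : L b^-1.
  move=> _ [k [l [m [n ->]]]]; exists (-1 + k)%R, l, m, n.
  by rewrite /heis_nf expgzN1D !mulgA.
have cz : commute c z.
  apply: commute_sym; rewrite /c /commg /conjg.
  by repeat apply: commuteM => //; apply: commuteV.
(* Used with [y = d], [e = c^-1], [j = -1] and with [y = d^-1], [e = c], [j = 1]: crossing $b^k$
   creates $e^k = c^{jk}$, which merges with $c^m$. *)
have dE e y k l m n j :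
    commute e b -> commute e y ->
    (forall i, expgz e i = expgz c (j * i)%R) -> y * b = b * y * e ->
  y * heis_nf k l m n =
    expgz b k * (y * expgz d l) * expgz c (j * k + m)%R * expgz z n.
  move=> eb ey ec yb.
  have cdl : commute (expgz c (j * k)%R) (expgz d l).
    do 2![apply: commute_sym; apply: commute_expgz].
    exact: commute_sym.
  rewrite /heis_nf !mulgA (mulg_expgz_comm k eb ey yb) ec expgzD !mulgA.
  by rewrite -(mulgA _ (expgz c _) (expgz d l)) cdl !mulgA.
have Ld : L d.
  move=> _ [k [l [m [n ->]]]]; exists k, (1 + l)%R, (-1 * k + m)%R, n.
  rewrite (@dE c^-1 _ _ _ _ _ (-1)%R) -?expgz1D //.
  - by apply: commute_sym; apply: commuteV; apply: commute_sym.
  - by apply: commute_sym; apply: commuteV; apply: commute_sym.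
  - by move=> i; rewrite expgzV mulN1r.
  - by rewrite /c invgR -commgC.
have LdV : L d^-1.
  move=> _ [k [l [m [n ->]]]]; exists k, (-1 + l)%R, (1 * k + m)%R, n.
  rewrite (@dE c _ _ _ _ _ 1%R) -?expgzN1D //.
  - exact: commuteV.
  - by move=> i; rewrite mul1r.
  - by rewrite -mulgA -(commuteV cd) /c /commg /conjg !mulgA mulgK mulgV mul1g.
have zB k l m : commute z (expgz b k * expgz d l * expgz c m).
  by do 2?apply: commuteM; apply: commute_expgz => //; exact: commute_sym.
have Lz : L z.
  move=> _ [k [l [m [n ->]]]]; exists k, l, m, (1 + n)%R.
  by rewrite /heis_nf mulgA zB expgz1D mulgA.
have LzV : L z^-1.
  move=> _ [k [l [m [n ->]]]]; exists k, l, m, (-1 + n)%R.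
  have zVB := commute_sym (commuteV (commute_sym (zB k l m))).
  by rewrite /heis_nf mulgA zVB expgzN1D mulgA.
have LM y y' : L y -> L y' -> L (y * y').
  by move=> Ly Ly' w /Ly' /Ly; rewrite mulgA.
move=> Px; suff [Lx _] : L x /\ L x^-1.
  rewrite -[x]mulg1; apply: Lx; exists 0%R, 0%R, 0%R, 0%R.
  by rewrite /heis_nf !mulg1.
elim: Px => {x} [_ [->|[->|->]]||x y _ [Lx LxV] _ [Ly LyV]|x _ [Lx LxV]] //.
- by split=> w; rewrite ?invg1 mul1g.
- by rewrite invgM; split; exact: LM.
- by rewrite invgK.
Qed.
End HeisenbergNormalForm.

Lemma gmulf_heis_nf (G H : groupType) (F : UMagmaMorphism.type G H)
    (b d z : G) (k l m n : int) :
  F (heis_nf b d z k l m n) = heis_nf (F b) (F d) (F z) k l m n.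
Proof. by rewrite /heis_nf !gmulfM /= !gmulf_expgz gmulfR. Qed.

(** * Coset decomposition over the pure braids *)

Section BraidNormalForm.
Variables (G : groupType) (s t : G).
Hypothesis sts : s * t * s = t * s * t.
Let a := s ^+ 2.
Let b := t * s ^+ 2 * t^-1.
Let d := t ^+ 2.
Let z := (s * t * s) ^+ 2.
Hypothesis rb : [~ b, b ^ d] = 1.
Hypothesis rd : [~ d, d ^ b] = 1.
(** Expresses that [s] and [t] generate [G], as induction on left multiplication by letters. *)
Hypothesis gen_st : forall P : G -> Prop, P 1 ->
  (forall x, P x -> [/\ P (s * x), P (t * x), P (s^-1 * x) & P (t^-1 * x)]) ->
  forall x, P x.

Let P := subgroup_gen [set y | y = a \/ y = b \/ y = d].

(** The half twist $D = sts$ swaps the generators, $sD = Dt$ and $tD = Ds$, so its square [z]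
    commutes with both. *)
Let sD : s * (s * t * s) = s * t * s * t.
Proof. by rewrite {1}sts !mulgA. Qed.

Let tD : t * (s * t * s) = s * t * s * s.
Proof. by rewrite {2}sts !mulgA. Qed.

Let commute_sqr (D u v : G) : u * D = D * v -> v * D = D * u -> commute (D ^+ 2) u.
Proof.
by move=> uD vD; rewrite /commute expg2 -mulgA -vD mulgA -uD mulgA.
Qed.

Let zs : commute z s.
Proof. by apply: (commute_sqr (v := t)); rewrite (sD, tD). Qed.

Let zt : commute z t.
Proof. by apply: (commute_sqr (v := s)); rewrite (sD, tD). Qed.

(** Lets [a] be traded for the central [z], leaving [b] and [d] as the only noncentral generators of
    the pure part. *)
Let zE : z = a * b * d.
Proof.
transitivity (s * (s * t * s) * s * t).
  by rewrite sD /z expg2 {2}sts !mulgA.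
by rewrite /a /b /d !expg2 !mulgA mulgVK.
Qed.

(** Presents [b] as a conjugate of [d] by [s], whereas its definition conjugates [a] by [t^-1]; this
    form makes conjugation by [s] computable. *)
Let bE : b = s^-1 * d * s.
Proof.
apply: (mulgI s); apply: (mulIg t).
rewrite /b /d !expg2 !mulgA mulgVK mulgV mul1g.
by rewrite -tD sts !mulgA.
Qed.

(** Conjugation by a letter sends each of [a], [b], [d] to one of them or to a conjugate of one by
    [a] or [d]. *)
Let PJ x y : (y = s \/ y = t) -> P x -> P (x ^ y).
Proof.
have Pa : P a by apply: subgroup_gen_mem; left.
have Pb : P b by apply: subgroup_gen_mem; right; left.
have Pd : P d by apply: subgroup_gen_mem; right; right.
have PJ u v : P u -> P v -> P (u ^ v).
  by move=> Pu Pv; do ?apply: subgroup_genM => //; exact: subgroup_genV.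
move=> ey; elim=> {x} [x ex||x x' _ Px _ Px'|x _ Px].
- case: ey => ->; case: ex => [->|[->|->]].
  + suff -> : a ^ s = a by [].
    by rewrite /a /conjg expg2 -mulgA mulKg.
  + suff -> : b ^ s = d ^ a by exact: PJ.
    by rewrite bE /a /conjg expg2 invgM !mulgA.
  + suff -> : d ^ s = b by [].
    by rewrite bE /conjg !mulgA.
  + suff -> : a ^ t = b ^ d by exact: PJ.
    by rewrite /b /a /d /conjg !expg2 invgM !mulgA !mulgVK.
  + suff -> : b ^ t = a by [].
    by rewrite /b /a /conjg !mulgA mulgVK mulVg mul1g.
  + suff -> : d ^ t = d by [].
    by rewrite /d /conjg expg2 -mulgA mulKg.
- by rewrite conj1g; exact: subgroup_gen1.
- by rewrite conjMg; exact: subgroup_genM.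
- by rewrite conjVg; exact: subgroup_genV.
Qed.

(** Positive minimal lifts of the six elements of $S_3$. *)
Let W := [:: 1; s; t; s * t; t * s; s * t * s].

Let PJW (w p : G) : w \in W -> P p -> P (p ^ w).
Proof.
have PJs u : P u -> P (u ^ s) by apply: PJ; left.
have PJt u : P u -> P (u ^ t) by apply: PJ; right.
rewrite !inE => /or4P[|||/or3P[]] /eqP-> Pp; rewrite ?conjg1 ?conjgM; auto.
Qed.

(** Left multiplication by [s] or [t] either moves within [W] or produces a square [a] or [d], which
    normality of [P] allows to be moved to the right. *)
Let coset (x : G) : exists w p : G, [/\ w \in W, P p & x = w * p].
Proof.
pose N (x : G) := exists w p : G, [/\ w \in W, P p & x = w * p].
have Pa : P a by apply: subgroup_gen_mem; left.
have Pd : P d by apply: subgroup_gen_mem; right; right.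
have NI w p : w \in W -> P p -> N (w * p) by exists w, p.
have Ns w p : w \in W -> P p -> N (s * (w * p)).
  rewrite {1}/W !inE => /or4P[|||/or3P[]] /eqP-> Pp.
  - by rewrite mul1g; apply: NI; rewrite ?inE ?eqxx ?orbT.
  - rewrite mulgA -expg2 -[_ * _]mul1g.
    by apply: NI; [rewrite ?inE ?eqxx ?orbT | exact: subgroup_genM].
  - by rewrite mulgA; apply: NI; rewrite ?inE ?eqxx ?orbT.
  - have -> : s * (s * t * p) = t * (a ^ t * p).
      by rewrite [RHS]mulgA -conjgC /a expg2 !mulgA.
    apply: NI; first by rewrite !inE eqxx ?orbT.
    by apply: subgroup_genM => //; apply: PJW; rewrite // !inE eqxx ?orbT.
  - by rewrite !mulgA -[_ * p]/(_ * p); apply: NI; rewrite ?inE ?eqxx ?orbT.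
  - have -> : s * (s * t * s * p) = t * s * (a ^ (t * s) * p).
      by rewrite [RHS]mulgA -conjgC /a expg2 !mulgA.
    apply: NI; first by rewrite !inE eqxx ?orbT.
    by apply: subgroup_genM => //; apply: PJW; rewrite // !inE eqxx ?orbT.
have Nt w p : w \in W -> P p -> N (t * (w * p)).
  rewrite {1}/W !inE => /or4P[|||/or3P[]] /eqP-> Pp.
  - by rewrite mul1g; apply: NI; rewrite ?inE ?eqxx ?orbT.
  - by rewrite mulgA; apply: NI; rewrite ?inE ?eqxx ?orbT.
  - rewrite mulgA -expg2 -[_ * _]mul1g.
    by apply: NI; [rewrite ?inE ?eqxx ?orbT | exact: subgroup_genM].
  - by rewrite !mulgA -sts; apply: NI; rewrite ?inE ?eqxx ?orbT.
  - have -> : t * (t * s * p) = s * (d ^ s * p).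
      by rewrite [RHS]mulgA -conjgC /d expg2 !mulgA.
    apply: NI; first by rewrite !inE eqxx ?orbT.
    by apply: subgroup_genM => //; apply: PJW; rewrite // !inE eqxx ?orbT.
  - have -> : t * (s * t * s * p) = s * t * (a * p).
      by rewrite mulgA tD /a expg2 !mulgA.
    by apply: NI; [rewrite ?inE ?eqxx ?orbT | exact: subgroup_genM].
(* Writing $u^{-1} = u\,u^{-2}$ reduces negative letters to positive ones: $u^{-2}$ is pure and
   passes to the right of [w]. *)
have mulVJ (u w p : G) : u^-1 * (w * p) = u * (w * ((u ^- 2) ^ w * p)).
  by rewrite (mulgA w) -conjgC expg2 invgM !mulgA mulgV mul1g.
apply: (@gen_st N) => [|_ [w [p [Ww Pp ->]]]].
  by rewrite -[1]mulg1; apply: NI; [rewrite ?inE ?eqxx | exact: subgroup_gen1].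
split; rewrite ?mulVJ; [exact: Ns | exact: Nt | apply: Ns | apply: Nt] => //;
  by apply: subgroup_genM => //; apply: PJW => //; exact: subgroup_genV.
Qed.

Let c := [~ b, d].

(** Since $b^d = bc$, the relator says that [b] commutes with $bc$, hence with [c]. The argument for
    [cd] is the same with $d^b = dc^{-1}$. *)
Let cb : commute c b.
Proof.
have := rb; rewrite (_ : b ^ d = b * c); last by rewrite /c commgEl mulVKg.
move=> /eqP/commgP; rewrite /commute -[b * c * b]mulgA => /mulgI bc.
exact: esym.
Qed.

Let cd : commute c d.
Proof.
have := rd; rewrite (_ : d ^ b = d * c^-1); last by rewrite /c invgR commgEl mulVKg.
move=> /eqP/commgP; rewrite /commute -[d * c^-1 * d]mulgA => /mulgI dc.
by apply: commute_sym; rewrite -[c]invgK; exact: commuteV.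
Qed.

Lemma braid_nf (x : G) :
  exists (w : G) k l m n, w \in W /\ x = w * heis_nf b d z k l m n.
Proof.
have [w [p [Ww Pp ->]]] := coset x.
have zb : commute z b.
  by rewrite /b; do ?apply: commuteM => //; apply: commuteV.
have zd : commute z d by exact: commuteX.
suff /(heis_nfP cb cd zb zd)[k [l [m [n ->]]]] :
  subgroup_gen [set y | y = b \/ y = d \/ y = z] p by exists w, k, l, m, n.
set S := subgroup_gen _; have [Sb Sd Sz] : [/\ S b, S d & S z].
  by split; apply: subgroup_gen_mem => /=; auto.
elim: Pp => {p} [p [->|[->|->]]||p q _ Sp _ Sq|p _ Sp] //.
- have -> : a = z * d^-1 * b^-1 by rewrite zE !mulgK.
  by do ?apply: subgroup_genM => //; exact: subgroup_genV.
- exact: subgroup_gen1.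
- exact: subgroup_genM.
- exact: subgroup_genV.
Qed.

End BraidNormalForm.

Local Open Scope ring_scope.

(** * An alternating form on $\mathbb{Z}^3$ *)

Section Omega.
Implicit Types (u v w : 'rV[int]_3) (p : 'S_3).

(** The triple product of [v], [w] and $(1,1,1)$. Its radical is spanned by $(1,1,1)$, so the image
    $(2,2,2)$ of the full twist pairs to zero with every vector. *)
Definition omega v w : int :=
  v 0 0 * w 0 1 - v 0 1 * w 0 0 + v 0 1 * w 0 2 - v 0 2 * w 0 1
    + v 0 2 * w 0 0 - v 0 0 * w 0 2.

Lemma omega_det v w :
  omega v w = \det (\matrix_(i < 3, j < 3) [:: v 0 j; w 0 j; 1]`_i).
Proof.
rewrite (expand_det_row _ 2) !big_ord_recl big_ord0 /cofactor.
rewrite !(expand_det_row _ 0) !big_ord_recl !big_ord0 /cofactor !det_mx11 !mxE.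
(* Reading entries through a function on naturals makes the ordinals left by the expansion compute,
   so that [ring] identifies equal entries. *)
have [f fE] : exists f : 'rV[int]_3 -> nat -> int, forall u (i : 'I_3), u 0 i = f u i.
  by exists (fun u n => u 0 (inord n)) => u i; rewrite inord_val.
rewrite /omega !fE /= /bump /=. ring.
Qed.

Lemma omegaDl u v w : omega (u + v) w = omega u w + omega v w.
Proof. by rewrite /omega !mxE; ring. Qed.

Lemma omegaDr u v w : omega u (v + w) = omega u v + omega u w.
Proof. by rewrite /omega !mxE; ring. Qed.

Lemma omegaNl v w : omega (- v) w = - omega v w.
Proof. by rewrite /omega !mxE; ring. Qed.

Lemma omegavv v : omega v v = 0.
Proof. by rewrite /omega; ring. Qed.

(** A column permutation fixes the row of ones, so it multiplies the determinant by its sign. *)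
Lemma omega_perm p v w :
  omega (col_perm p v) (col_perm p w) = (-1) ^+ p * omega v w.
Proof.
rewrite !omega_det; set A := (X in _ * \det X).
have -> : \matrix_(i, j) [:: col_perm p v 0 j; col_perm p w 0 j; 1]`_i
    = col_perm p A by apply/matrixP=> i j; rewrite !mxE.
by rewrite col_permE det_mulmx det_perm odd_permV mulrC.
Qed.

End Omega.

(* The semidirect product of S_3 and the central extension of Z^3 by Z with
   cocycle 3 [omega]; S_3 permutes the coordinates of Z^3 and acts on Z by the
   sign. The Z^3-part of a pure braid will be twice its vector of linking
   numbers, with the pair of strands {i, j} indexed by the third strand;
   this makes sigma_1 and sigma_2 unit vectors, and the factor 3 in front of
   [omega] is what makes the braid relation solvable over the integers. *)
Definition heis3 : Type := ('rV[int]_3 * int * 'S_3)%type.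
HB.instance Definition _ := Choice.on heis3.

Section Heis3.
Implicit Types x y z : heis3.

Definition heis3_one : heis3 := (0, 0, 1%g).

Definition heis3_mul x y : heis3 :=
  (x.1.1 + col_perm x.2 y.1.1,
   x.1.2 + (-1) ^+ x.2 * y.1.2 + 3 * omega x.1.1 (col_perm x.2 y.1.1),
   (x.2 * y.2)%g).

Definition heis3_inv x : heis3 :=
  (- col_perm x.2^-1 x.1.1, - ((-1) ^+ x.2 * x.1.2), x.2^-1%g).

Lemma heis3_mulA : associative heis3_mul.
Proof.
move=> [[u r] p] [[v s] q] [[w t] k]; rewrite /heis3_mul /=; congr (_, _, _).
- by rewrite raddfD addrA col_permM.
- rewrite col_permM raddfD omegaDl omegaDr omega_perm odd_permM signr_addb.
  by move: ((-1) ^+ p) ((-1) ^+ q) => a b; ring.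
- by rewrite mulgA.
Qed.

Lemma heis3_mul1 : left_id heis3_one heis3_mul.
Proof.
move=> [[u r] p]; rewrite /heis3_mul /= odd_perm1 col_perm1 mul1g.
by congr (_, _, _); rewrite ?add0r // /omega !mxE; ring.
Qed.

Lemma heis3_mulr1 : right_id heis3_one heis3_mul.
Proof.
move=> [[u r] p]; rewrite /heis3_mul /= mulg1 raddf0 addr0 mulr0 addr0.
by congr (_, _, _); rewrite /omega !mxE; ring.
Qed.

Lemma heis3_mulV : left_inverse heis3_one heis3_inv heis3_mul.
Proof.
move=> [[u r] p]; rewrite /heis3_mul /= mulVg addNr omegaNl omegavv odd_permV.
by rewrite mulr0 addr0 addNr.
Qed.

Lemma heis3_mulrV : right_inverse heis3_one heis3_inv heis3_mul.
Proof.
move=> [[u r] p]; rewrite /heis3_mul /= mulgV.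
have -> : col_perm p (- col_perm p^-1 u) = - u.
  rewrite raddfN /=.
  by rewrite -col_permM mulgV col_perm1.
rewrite subrr mulrN mulrA -expr2 sqrr_sign mul1r subrr add0r.
by congr (_, _, _); rewrite /omega !mxE; ring.
Qed.

HB.instance Definition _ := isGroup.Build heis3
  heis3_mulA heis3_mul1 heis3_mulr1 heis3_mulV heis3_mulrV.

End Heis3.

(** * Coordinates in [heis3] and the images of the generators *)

Definition heis3_elt (x y z r : int) (p : 'S_3) : heis3 :=
  (\row_(j < 3) [:: x; y; z]`_j, r, p).

Local Notation swap01 := (tperm 0 1 : 'S_3).
Local Notation swap12 := (tperm 1 2 : 'S_3).

(** With these unit vectors the braid relation holds exactly when the two central coordinates differ
    by 2; the choice 1 and -1 gives the half twist central coordinate 0. *)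
Definition heis3_s : heis3 := heis3_elt 0 0 1 1 swap01.
Definition heis3_t : heis3 := heis3_elt 1 0 0 (-1) swap12.

Lemma heis3_elt_inj x y z r p x' y' z' r' p' :
  heis3_elt x y z r p = heis3_elt x' y' z' r' p' ->
  [/\ x = x', y = y', z = z', r = r' & p = p'].
Proof.
by case=> /rowP v -> ->; split=> //; [move: (v 0) | move: (v 1) | move: (v 2)];
  rewrite !mxE.
Qed.

Lemma heis3_pureM x y z r x' y' z' r' p :
  (heis3_elt x y z r 1 * heis3_elt x' y' z' r' p)%g =
  heis3_elt (x + x') (y + y') (z + z')
    (r + r' + 3 * (x * y' - y * x' + y * z' - z * y' + z * x' - x * z')) p.
Proof.
rewrite /heis3_elt -[LHS]/(heis3_mul _ _) /heis3_mul /= col_perm1 mul1g odd_perm1.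
congr (_, _, _); last by rewrite expr0 mul1r /omega !mxE /=.
by apply/rowP=> -[[|[|[|//]]] ?]; rewrite !mxE.
Qed.

Lemma heis3_sM x y z r p :
  (heis3_s * heis3_elt x y z r p)%g =
  heis3_elt y x (1 + z) (1 - r + 3 * (y - x)) (swap01 * p)%g.
Proof.
rewrite /heis3_elt -[LHS]/(heis3_mul _ _) /heis3_mul /= odd_tperm expr1.
congr (_, _, _); last by rewrite /omega !mxE !permE /=; ring.
by apply/rowP=> -[[|[|[|//]]] ?]; rewrite !mxE !permE /= ?add0r.
Qed.

Lemma heis3_tM x y z r p :
  (heis3_t * heis3_elt x y z r p)%g =
  heis3_elt (1 + x) z y (-1 - r + 3 * (z - y)) (swap12 * p)%g.
Proof.
rewrite /heis3_elt -[LHS]/(heis3_mul _ _) /heis3_mul /= odd_tperm expr1.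
congr (_, _, _); last by rewrite /omega !mxE !permE /=; ring.
by apply/rowP=> -[[|[|[|//]]] ?]; rewrite !mxE !permE /= ?add0r.
Qed.

Lemma heis3_1 : 1%g = heis3_elt 0 0 0 0 1%g.
Proof.
congr (_, _, _); apply/rowP=> -[[|[|[|//]]] ?]; by rewrite !mxE.
Qed.

Lemma heis3_pureV x y z r :
  (heis3_elt x y z r 1)^-1%g = heis3_elt (- x) (- y) (- z) (- r) 1%g.
Proof.
apply: (mulgI (heis3_elt x y z r 1)); rewrite mulgV heis3_pureM heis3_1.
by congr heis3_elt; ring.
Qed.

(** Proportional vectors pair to zero under [omega], so powers acquire no quadratic term. *)
Lemma heis3_pureX x y z r k :
  expgz (heis3_elt x y z r 1) k = heis3_elt (k * x) (k * y) (k * z) (k * r) 1%g.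
Proof.
set g := heis3_elt x y z r 1.
apply: (@expgz_rec _ g (fun k w => w = heis3_elt (k * x) (k * y) (k * z) (k * r) 1%g)) =>
  [|l _ ->|l _ ->].
- by rewrite !mul0r heis3_1.
- by rewrite heis3_pureM; congr heis3_elt; ring.
- by rewrite heis3_pureV heis3_pureM; congr heis3_elt; ring.
Qed.

Lemma heis3_pure_torsion x y z r m : (0 < m)%N ->
  (heis3_elt x y z r 1 ^+ m = 1)%g -> [/\ x = 0, y = 0, z = 0 & r = 0].
Proof.
move=> m0; have -> g : (g ^+ m)%g = expgz g (Posz m) by [].
rewrite heis3_pureX heis3_1 => /heis3_elt_inj[xm ym zm rm _].
have mI u : Posz m * u = 0 -> u = 0.
  by move/eqP; rewrite mulf_eq0 => /orP[/eqP|/eqP //]; lia.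
by split; exact: mI.
Qed.

Lemma heis3_braid : (heis3_s * heis3_t * heis3_s = heis3_t * heis3_s * heis3_t)%g.
Proof.
rewrite -!mulgA {2}/heis3_s {3}/heis3_t !(heis3_sM, heis3_tM).
congr heis3_elt; apply/permP=> -[[|[|[|//]]] ?]; rewrite !permM.
all: by do 6!rewrite permE /=; apply/val_inj.
Qed.

(** Elements over the identity permutation form a group of class two, in which [g ^ h] differs from
    [g] by a central factor. This kills the homotopy relators in [heis3]. *)
Lemma heis3_pureR (g h : heis3) : g.2 = 1%g -> h.2 = 1%g -> [~ g, g ^ h]%g = 1%g.
Proof.
have eltP (f : heis3) : exists x y z r, f = heis3_elt x y z r f.2.
  exists (f.1.1 0 0), (f.1.1 0 1), (f.1.1 0 2), f.1.2.
  case: f => [[v r] p]; congr (_, _, _); apply/rowP=> -[[|[|[|//]]] ?] /=;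
  by rewrite mxE /=; congr (v _ _); apply/val_inj.
have [x [y [z [r ->]]]] := eltP g; have [x' [y' [z' [r' ->]]]] := eltP h.
move=> /= -> ->; apply/eqP/commgP.
rewrite /commute /conjg heis3_pureV !heis3_pureM.
by congr heis3_elt; ring.
Qed.

Local Open Scope group_scope.
Local Open Scope quotient_scope.

(** * From the presentation to [heis3] *)

Local Notation hbraid3 := (homotopy_braid_group 3).

Lemma sigma_gen n (i : 'I_n.-1) : sigma n i = \pi_(braid_group n) (free_gen i).
Proof. by rewrite /sigma valK. Qed.

Lemma braid_group_ind n (P : braid_group n -> Prop) :
  P 1 ->
  (forall (i : 'I_n.-1) x, P x -> P (sigma n i * x) /\ P ((sigma n i)^-1 * x)) ->
  forall x, P x.
Proof.
move=> P1 Pstep; elim/quotW; elim/free_group_ind => [//|i u|i u] /(Pstep i)[].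
- by rewrite sigma_gen -quot_piM.
- by rewrite sigma_gen -quot_piV -!quot_piM.
Qed.

Lemma sigma_braid n i : (i.+2 < n)%N ->
  sigma n i * sigma n i.+1 * sigma n i = sigma n i.+1 * sigma n i * sigma n i.+1.
Proof.
move=> lt_i.
have lti : (i < n.-1)%N by lia.
have ltj : (i.+1 < n.-1)%N by lia.
rewrite (sigma_gen (Ordinal lti)) (sigma_gen (Ordinal ltj)).
apply: divg1_eq; rewrite -!(quot_piM, quot_piV). apply: quot_pi_rel.
by left; exists (Ordinal lti), (Ordinal ltj).
Qed.

Definition hsigma (k : nat) : hbraid3 := \pi_(hbraid3) (sigma 3 k).

Lemma hbraid3_ind (P : hbraid3 -> Prop) :
  P 1 ->
  (forall x, P x -> [/\ P (hsigma 0 * x), P (hsigma 1 * x),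
     P ((hsigma 0)^-1 * x) & P ((hsigma 1)^-1 * x)]) ->
  forall x, P x.
Proof.
move=> P1 Pstep; elim/quotW; elim/braid_group_ind => [//|i x /Pstep].
rewrite /hsigma -!(quot_piV, quot_piM) => -[].
by case: i => -[|[|//]] i_lt.
Qed.

Lemma hsigma_braid :
  hsigma 0 * hsigma 1 * hsigma 0 = hsigma 1 * hsigma 0 * hsigma 1.
Proof. by rewrite /hsigma -!quot_piM sigma_braid. Qed.

Lemma hsigma_relators (b := hsigma 1 * hsigma 0 ^+ 2 * (hsigma 1)^-1)
    (d := hsigma 1 ^+ 2) :
  [~ b, b ^ d] = 1 /\ [~ d, d ^ b] = 1.
Proof.
have bE : b = \pi_(hbraid3) (pure_gen 3 0 2).
  rewrite /pure_gen -[rev _]/[:: 1%N] big_seq1 !expg2.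
  by rewrite /b /hsigma !(quot_piV, quot_piM) !mulgA.
have dE : d = \pi_(hbraid3) (pure_gen 3 1 2).
  rewrite /pure_gen -[rev _]/[::] big_nil mul1g invg1 mulg1 !expg2.
  by rewrite !(quot_piV, quot_piM).
(* Relators of the last strand, numbered 2, with a single generator as conjugating element. *)
have rel i j : (i < 2)%N -> (j < 2)%N ->
    let x := \pi_(hbraid3) (pure_gen 3 i 2) in
    [~ x, x ^ \pi_(hbraid3) (pure_gen 3 j 2)] = 1.
  move=> i2 j2 x; rewrite /x /commg /conjg -!(quot_piV, quot_piM).
  apply: quot_pi_rel; exists i, 2%N, (pure_gen 3 j 2); split => //.
    by rewrite i2.
  by apply: subgroup_gen_mem; exists j.
by rewrite bE dE !rel.
Qed.

(** The map is lifted through the free group, the braid group and the homotopy quotient in turn. The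
    last stage rests on pure generators having trivial permutation part. *)
Lemma hbraid3_heis3 :
  exists F : UMagmaMorphism.type hbraid3 heis3,
    F (hsigma 0) = heis3_s /\ F (hsigma 1) = heis3_t.
Proof.
have [F1 F1E] := free_group_lift
  (fun i : 'I_2 => if i == 0%R then heis3_s else heis3_t).
have [r|F2 F2E] := @group_quot_lift _ _ (@braid_relators 3) F1.
  case=> [[i [j [ji ->]]]|[i [j [ij _]]]].
    rewrite gmulfF /= !gmulfM /= !F1E.
    have -> : i = 0%R by apply/val_inj => /=; move: (ltn_ord i) (ltn_ord j) ji => /=; lia.
    have -> : j = 1%R by apply/val_inj => /=; move: (ltn_ord i) (ltn_ord j) ji => /=; lia.
    by rewrite /= heis3_braid divgg.
  (* Two generators leave no pair of indices at distance 2. *)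
  by move: (ltn_ord i) (ltn_ord j) ij => /=; lia.
(* Covers every [k]: out of range, [sigma 3 k] is 1 by default. *)
have F2s k : (F2 (sigma 3 k) ^+ 2).2 = 1.
  rewrite /sigma; case: insubP => [i _ _|_]; last by rewrite gmulf1 expg1n.
  by rewrite F2E F1E; case: ifP => _; exact: tperm2.
have F2p i k : (F2 (pure_gen 3 i k)).2 = 1.
  rewrite /pure_gen !gmulfM /= gmulfV; set f := F2 (\prod_(_ <- _) _).
  rewrite -[LHS]/(f.2 * (F2 (sigma 3 i) ^+ 2).2 * f.2^-1).
  by rewrite F2s mulg1 mulgV.
have F2g k g : subgroup_gen [set pure_gen 3 j k | j in [set j | (j < k)%N]] g ->
    (F2 g).2 = 1.
  elim=> {g} [_ [j _ <-]||g h _ Fg _ Fh|g _ Fg].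
  - exact: F2p.
  - by rewrite gmulf1.
  - by rewrite gmulfM -[LHS]/((F2 g).2 * (F2 h).2) Fg Fh mulg1.
  - by rewrite gmulfV -[LHS]/((F2 g).2^-1) Fg invg1.
have [r|F3 F3E] := @group_quot_lift _ _ (@homotopy_relators 3) F2.
  case=> i [k [g [_ /F2g Fg ->]]].
  by rewrite gmulfR /= gmulfJ /= heis3_pureR.
exists F3; rewrite /hsigma !F3E.
by rewrite (@sigma_gen 3 0%R) (@sigma_gen 3 1%R) !F2E !F1E.
Qed.

(** * Excluding torsion coset by coset *)

Lemma tperm_mulK (T : finType) (x y : T) (p : {perm T}) :
  tperm x y * (tperm x y * p) = p.
Proof. by rewrite mulgA tperm2 mul1g. Qed.

(** The images of $b$, $d$, $z$, $[b,d]$ are $(0,2,0;12)$, $(2,0,0;0)$, $(2,2,2;0)$, $(0,0,0;-24)$;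
    the term $-12kl$ is the cocycle between $b^k$ and $d^l$. The coordinates yield [n], then [l],
    [k] and [i]. *)
Lemma heis3_nf k l i n :
  heis_nf (heis3_t * heis3_s ^+ 2 * heis3_t^-1) (heis3_t ^+ 2)
    ((heis3_s * heis3_t * heis3_s) ^+ 2) k l i n =
  heis3_elt (2 * n + 2 * l)%R (2 * k + 2 * n)%R (2 * n)%R
    (12 * k - 12 * k * l - 24 * i)%R 1.
Proof.
have -> : heis3_t * heis3_s ^+ 2 * heis3_t^-1 = heis3_elt 0%R 2 0%R 12 1.
  apply: (mulIg heis3_t); rewrite mulgVK expg2 {2}/heis3_t {2}/heis3_s.
  rewrite !(heis3_sM, heis3_tM) heis3_pureM; congr heis3_elt.
  by rewrite tperm2 mulg1.
have -> : heis3_t ^+ 2 = heis3_elt 2 0%R 0%R 0%R 1.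
  by rewrite expg2 {2}/heis3_t heis3_tM tperm2.
have -> : (heis3_s * heis3_t * heis3_s) ^+ 2 = heis3_elt 2 2 2 0%R 1.
  rewrite expg2 -!mulgA {4}/heis3_s !(heis3_sM, heis3_tM); congr heis3_elt.
  by rewrite !tperm_mulK tperm2.
rewrite /heis_nf /commg /conjg !heis3_pureV !heis3_pureM !heis3_pureX.
by rewrite !heis3_pureM; congr heis3_elt; ring.
Qed.

Lemma swap_cycle3 : (swap01 * swap12) ^+ 3 = 1 /\ (swap12 * swap01) ^+ 3 = 1.
Proof.
rewrite !expgS !expg0 !mulg1; split; apply/permP=> -[[|[|[|//]]] ?].
all: by rewrite !permM; do !rewrite permE /=; apply/val_inj.
Qed.

Theorem theorem4p4 : torsion_free (homotopy_braid_group 3).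
Proof.
move=> x m m0 xm; have [F [Fs Ft]] := hbraid3_heis3.
have [rb rd] := hsigma_relators.
have [w [k [l [i [n [Ww xE]]]]]] := braid_nf hsigma_braid rb rd hbraid3_ind x.
have FX j : (F x ^+ j) ^+ m = 1.
  by rewrite expgnAC -gmulfXn /= xm gmulf1 expg1n.
have Fx := congr1 F xE; move: Fx.
rewrite gmulfM /= gmulf_heis_nf !(gmulfM, gmulfV, gmulfXn) /= Fs Ft.
rewrite [heis_nf _ _ _ _ _ _ _]heis3_nf => Fx.
have [c1 c2] := swap_cycle3; move: c1 c2; rewrite !expgS !expg0 !mulg1 -!mulgA => c1 c2.
move: Ww; rewrite !inE => /or4P[|||/or3P[]] /eqP wE; move: Fx;
  rewrite wE ?gmulf1 ?gmulfM /= ?gmulfM /= ?Fs ?Ft => Fx.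
- have := FX 1%N; rewrite Fx expg1 mul1g => /(heis3_pure_torsion m0)[v0 v1 v2 r0].
  have n0 : n = 0%R by lia.
  have l0 : l = 0%R by lia.
  have k0 : k = 0%R by lia.
  have i0 : i = 0%R by move: r0; rewrite k0; lia.
  by rewrite xE wE k0 l0 i0 n0 /heis_nf !mulg1.
(* For $w = s$ the third coordinate of the square is $2 + 4n$. *)
- have := FX 2; rewrite Fx expg2 -!mulgA !(heis3_sM, heis3_pureM) mulg1 tperm2.
  by case/(heis3_pure_torsion m0); lia.
(* For $w = t$ the first coordinate is $2 + 4(n + l)$. *)
- have := FX 2; rewrite Fx expg2 -!mulgA !(heis3_tM, heis3_pureM) mulg1 tperm2.
  by case/(heis3_pure_torsion m0); lia.
- have := FX 3; rewrite Fx !expgS expg0 mulg1 -!mulgA.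
  rewrite !(heis3_sM, heis3_tM, heis3_pureM) mulg1 c1.
  (* The three coordinates of the cube all equal $2(1 + k + l + 3n)$. If they vanish, the central
     coordinate is 6 mod 9. *)
  case/(heis3_pure_torsion m0)=> v0 _ _; have -> : l = (-1 - 3 * n - k)%R by lia.
  lia.
- have := FX 3; rewrite Fx !expgS expg0 mulg1 -!mulgA.
  rewrite !(heis3_sM, heis3_tM, heis3_pureM) mulg1 c2.
  (* Same vector as for $st$; the central coordinate is now 3 mod 9. *)
  case/(heis3_pure_torsion m0)=> v0 _ _; have -> : l = (-1 - 3 * n - k)%R by lia.
  lia.
(* For $w = sts$ the second coordinate is $2 + 4(k + n)$. *)
- have := FX 2; rewrite Fx expg2 -!mulgA.
  rewrite !(heis3_sM, heis3_tM, heis3_pureM) mulg1 !tperm_mulK tperm2.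
  by case/(heis3_pure_torsion m0); lia.
Qed.
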